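(* For every integer $n\ge 0$, there is a bijection between the set of isomorphism classes of split graphs on $n$ vertices and the set of isomorphism classes of $XY$-graphs on $n$ vertices with no isolates in $Y$.
   Context: A finite graph is a split graph if its vertex set can be partitioned into a clique and a stable set. An $XY$-graph is a bipartite graph together with a specified ordered bipartition $X\cup Y$ of its vertex set (every edge joins $X$ to $Y$; $X$ is the distinguished part); isomorphisms of $XY$-graphs must map $X$ onto $X'$ and $Y$ onto $Y'$. A vertex of $Y$ is an isolate if it has no neighbor. *)

(* Defs.v *)
From HB Require Import structures.
From mathcomp Require Import all_boot all_fingroup.

Set Implicit Arguments.
Unset Strict Implicit.
Unset Printing Implicit Defensive.

Section Graphs.
Variable T : finType.

(* Each edge is stored as its two ordered pairs. *)
Definition sgraph_axiom (A : {set T * T}) : bool :=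
  [forall x, (x, x) \notin A] &&
  [forall x, forall y, ((x, y) \in A) == ((y, x) \in A)].

Record sgraph := SGraph {
  arcs : {set T * T};
  _ : sgraph_axiom arcs
}.

HB.instance Definition _ := [isSub for arcs].
HB.instance Definition _ := [Finite of sgraph by <:].

Definition adj (G : sgraph) : rel T := fun x y => (x, y) \in arcs G.

Definition clique (G : sgraph) (K : {set T}) : bool :=
  [forall x in K, forall y in K, (x != y) ==> adj G x y].

Definition stable (G : sgraph) (S : {set T}) : bool :=
  [forall x in S, forall y in S, ~~ adj G x y].

(* Either part of the partition may be empty. *)
Definition is_split (G : sgraph) : bool :=
  [exists K : {set T}, exists S : {set T},
    [&& K :|: S == setT, [disjoint K & S], clique G K & stable G S]].

Definition is_iso (G H : sgraph) (s : {perm T}) : bool :=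
  [forall x, forall y, adj H (s x) (s y) == adj G x y].

Definition sg_iso : rel sgraph := fun G H => [exists s, is_iso G H s].

(* The second component is X, and Y is its complement; both may be empty. *)
Definition xygraph_axiom (B : sgraph * {set T}) : bool :=
  stable B.1 B.2 && stable B.1 (~: B.2).

Record xygraph := XYGraph {
  xy_val : sgraph * {set T};
  _ : xygraph_axiom xy_val
}.

HB.instance Definition _ := [isSub for xy_val].
HB.instance Definition _ := [Finite of xygraph by <:].

Definition xy_graph (B : xygraph) : sgraph := (xy_val B).1.
Definition xy_X (B : xygraph) : {set T} := (xy_val B).2.
Definition xy_Y (B : xygraph) : {set T} := ~: xy_X B.

Definition xy_iso : rel xygraph := fun B C =>
  [exists s : {perm T},
    [&& is_iso (xy_graph B) (xy_graph C) s,
        s @: xy_X B == xy_X C & s @: xy_Y B == xy_Y C]].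

Definition isolate (G : sgraph) (y : T) : bool := [forall x, ~~ adj G x y].

Definition no_isolates_in_Y (B : xygraph) : bool :=
  [forall y in xy_Y B, ~~ isolate (xy_graph B) y].

Lemma is_iso1 G : is_iso G G 1%g.
Proof. by apply/forallP=> x; apply/forallP=> y; rewrite !perm1. Qed.

Lemma is_isoV G H s : is_iso G H s -> is_iso H G s^-1%g.
Proof.
move=> /forallP h; apply/forallP=> x; apply/forallP=> y.
by move/forallP/(_ (s^-1%g y))/eqP: (h (s^-1%g x)); rewrite !permKV => ->.
Qed.

Lemma is_isoM G H K s t : is_iso G H s -> is_iso H K t -> is_iso G K (s * t)%g.
Proof.
move=> /forallP h /forallP k; apply/forallP=> x; apply/forallP=> y.
rewrite !permM; move/forallP/(_ (s y))/eqP: (k (s x)) => ->.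
exact: (forallP (h x) y).
Qed.

Lemma sg_iso_refl : reflexive sg_iso.
Proof. by move=> G; apply/existsP; exists 1%g; apply: is_iso1. Qed.

Lemma sg_iso_sym : symmetric sg_iso.
Proof.
by move=> G H; apply/existsP/existsP=> -[s /is_isoV hs]; exists s^-1%g.
Qed.

Lemma sg_iso_trans : transitive sg_iso.
Proof.
move=> H G K /existsP[s hs] /existsP[t ht].
by apply/existsP; exists (s * t)%g; apply: is_isoM hs ht.
Qed.

Lemma imset_permV (s : {perm T}) (A B : {set T}) :
  s @: A = B -> s^-1%g @: B = A.
Proof.
by move=> <-; rewrite -imset_comp (eq_imset _ (permK s)) imset_id.
Qed.

Lemma imset_permM (s t : {perm T}) (A : {set T}) :
  (s * t)%g @: A = t @: (s @: A).
Proof. by rewrite -imset_comp; apply: eq_imset => x; rewrite permM. Qed.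

Lemma xy_iso_refl : reflexive xy_iso.
Proof.
move=> B; apply/existsP; exists 1%g; rewrite is_iso1.
by rewrite !(eq_imset _ (@perm1 T)) !imset_id !eqxx.
Qed.

Lemma xy_iso_sym : symmetric xy_iso.
Proof.
by move=> B C; apply/existsP/existsP=> -[s /and3P[/is_isoV hs /eqP hX /eqP hY]];
  exists s^-1%g; rewrite hs (imset_permV hX) (imset_permV hY) !eqxx.
Qed.

Lemma xy_iso_trans : transitive xy_iso.
Proof.
move=> C B D /existsP[s /and3P[hs /eqP sX /eqP sY]].
move=> /existsP[t /and3P[ht /eqP tX /eqP tY]].
apply/existsP; exists (s * t)%g.
by rewrite (is_isoM hs ht) !imset_permM sX sY tX tY !eqxx.
Qed.

End Graphs.

(* Every n-vertex graph is isomorphic to one with vertex set 'I_n, so classes *)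
(* are taken among those.                                                     *)
Definition split_classes (n : nat) : {set {set sgraph 'I_n}} :=
  equivalence_partition (@sg_iso 'I_n) [set G | is_split G].

Definition xy_classes (n : nat) : {set {set xygraph 'I_n}} :=
  equivalence_partition (@xy_iso 'I_n) [set B | no_isolates_in_Y B].

(* Main.v *)
Require Import Defs.
From mathcomp Require Import all_boot all_fingroup.

(**
Completing [Y] to a clique turns an [XY]-graph into a split graph; [Y] has no
isolates exactly when every clique vertex has a neighbor in the stable set [X].
Moving a clique vertex without neighbor in the stable part to the stable part
shows that every split graph has such a partition.  If [S] and [S'] are the
stable parts of two such partitions, then either [S = S'], or [S] and [S'] differ
by exchanging one vertex [a] for one vertex [b]; in that case [a] and [b] are
twins, so the transposition [(a b)] is an automorphism mapping [S] to [S'].  Hence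
the partition, and with it the [XY]-graph, is determined up to isomorphism.
*)

Set Implicit Arguments.
Unset Strict Implicit.
Unset Printing Implicit Defensive.

(** * Bijections between the classes of two relations *)

Section EquivalencePartitionBijection.
Variables (T1 T2 : finType) (R1 : rel T1) (R2 : rel T2).
Variables (D1 : {set T1}) (D2 : {set T2}) (g : T2 -> T1).
Hypotheses (R1_sym : symmetric R1) (R1_trans : transitive R1).
Hypothesis R2_refl : reflexive R2.
Hypothesis gD : {in D2, forall y, g y \in D1}.
Hypothesis g_mono : {in D2 &, {mono g : x y / R2 x y >-> R1 x y}}.
Hypothesis g_surj : {in D1, forall x, exists2 y, y \in D2 & R1 x (g y)}.

(** By [g_mono] and [g_surj], [g] induces a bijection from the classes of [R2] to those of [R1].
    Taking preimages gives its inverse without choosing representatives. *)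
Let pull (C : {set T1}) : {set T2} := [set y in D2 | g y \in C].

Let pull_class y : y \in D2 ->
  pull [set x in D1 | R1 (g y) x] = [set z in D2 | R2 y z].
Proof.
move=> yD; apply/setP=> z; rewrite !inE.
by case: (boolP (z \in D2)) => // zD; rewrite gD //= g_mono.
Qed.

Let class_repr C : C \in equivalence_partition R1 D1 ->
  exists2 y, y \in D2 & C = [set x in D1 | R1 (g y) x].
Proof.
case/imsetP=> x xD ->; have [y yD xy] := g_surj xD; exists y => //.
apply/setP=> z; rewrite !inE; congr (_ && _).
by apply/idP/idP; apply: R1_trans; rewrite // R1_sym.
Qed.

Lemma equivalence_partition_bij :
  exists f : {C : {set T1} | C \in equivalence_partition R1 D1} ->
             {D : {set T2} | D \in equivalence_partition R2 D2}, bijective f.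
Proof.
have pullP (C : {C : {set T1} | C \in equivalence_partition R1 D1}) :
    pull (val C) \in equivalence_partition R2 D2.
  have [y yD ->] := class_repr (valP C).
  by rewrite pull_class //; apply: imset_f.
pose f C : {D : {set T2} | D \in equivalence_partition R2 D2} :=
  exist (fun D => is_true (D \in _)) _ (pullP C).
have finj : injective f.
  move=> C C' /(congr1 val) /= eqCC'.
  apply: val_inj; have [y yD eC] := class_repr (valP C).
  have [y' y'D eC'] := class_repr (valP C').
  have : y' \in pull (val C).
    rewrite [pull _]eqCC' [val C']eC' pull_class //.
    by rewrite inE y'D R2_refl.
  rewrite [val C]eC pull_class // inE y'D /= -g_mono // => yy'.
  rewrite [val C']eC'; apply/setP=> z; rewrite !inE; congr (_ && _).
  by apply/idP/idP; apply: R1_trans; rewrite // R1_sym.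
(* It remains to bound the number of target classes by the number of source classes. The latter is
   the size of [codom f], so it suffices that every class [D] is a value of [f]. *)
exists f; apply: inj_card_bij => //.
rewrite -(card_codom (f := f)); last exact: finj.
apply/subset_leq_card/subsetP=> -[D DP] _; case/imsetP: (DP) => y yD eD.
have CP : [set x in D1 | R1 (g y) x] \in equivalence_partition R1 D1.
  by apply: imset_f; apply: gD.
apply/codomP; exists (exist (fun C => is_true (C \in _)) _ CP); apply: val_inj.
by rewrite /= pull_class.
Qed.

End EquivalencePartitionBijection.

(** * Adjacency, stable sets, cliques and isomorphisms *)

Section SplitXY.
Variable T : finType.
Implicit Types (G H : sgraph T) (B C : xygraph T) (S : {set T}).

Lemma adj_sym G : symmetric (adj G).
Proof.
by move=> x y; case/andP: (valP G) => _ /forallP/(_ x)/forallP/(_ y)/eqP.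
Qed.

Lemma adj_irr G x : adj G x x = false.
Proof. by case/andP: (valP G) => /forallP/(_ x)/negbTE. Qed.

Lemma sgraph_eq G H : adj G =2 adj H -> G = H.
Proof. by move=> h; apply: val_inj; apply/setP=> -[x y]; apply: h. Qed.

Lemma sgraph_of_subproof (e : rel T) :
  sgraph_axiom [set p : T * T | (p.1 != p.2) && (e p.1 p.2 || e p.2 p.1)].
Proof.
apply/andP; split; apply/forallP=> x; first by rewrite inE eqxx.
by apply/forallP=> y; rewrite !inE /= (eq_sym x) orbC.
Qed.

Definition sgraph_of (e : rel T) : sgraph T := SGraph (sgraph_of_subproof e).

Lemma adj_sgraph_of e x y :
  adj (sgraph_of e) x y = (x != y) && (e x y || e y x).
Proof. by rewrite /adj inE. Qed.

Lemma stableP G S :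
  reflect {in S &, forall x y, ~~ adj G x y} (stable G S).
Proof.
apply: (iffP forall_inP) => h x.
  by move=> y xS yS; apply: (forall_inP (h x xS)).
by move=> xS; apply/forall_inP=> y; apply: h.
Qed.

Lemma cliqueP G S :
  reflect {in S &, forall x y, x != y -> adj G x y} (clique G S).
Proof.
apply: (iffP forall_inP) => h x.
  by move=> y xS yS; apply/implyP; apply: (forall_inP (h x xS)).
by move=> xS; apply/forall_inP=> y yS; apply/implyP; apply: h.
Qed.

Lemma is_isoP G H (s : {perm T}) :
  reflect (forall x y, adj H (s x) (s y) = adj G x y) (is_iso G H s).
Proof.
apply: (iffP forallP) => h x; last by apply/forallP=> y; rewrite h.
by move=> y; apply/eqP; apply: (forallP (h x)).
Qed.

Lemma imset_permP (s : {perm T}) S S' :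
  reflect (forall x, (s x \in S') = (x \in S)) (s @: S == S').
Proof.
apply: (iffP eqP) => [<- x|h]; first by rewrite mem_imset //; apply: perm_inj.
apply/setP=> x; rewrite -(permKV s x) h mem_imset //; exact: perm_inj.
Qed.

Lemma xy_isoP B C :
  reflect (exists2 s, is_iso (xy_graph B) (xy_graph C) s &
             forall x, (s x \in xy_X C) = (x \in xy_X B))
          (xy_iso B C).
Proof.
apply: (iffP existsP) => -[s].
  by case/and3P=> hs /imset_permP hX _; exists s.
move=> hs hX; exists s; rewrite hs /=; apply/andP.
by split; apply/imset_permP=> // x; rewrite !inE hX.
Qed.

Lemma xy_adj_cross B x y : adj (xy_graph B) x y ->
  (x \in xy_X B) != (y \in xy_X B).
Proof.
have /andP[/stableP hX /stableP hY] := valP B; apply: contraL => /eqP eqX.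
by case: (boolP (x \in xy_X B)) (esym eqX) => xX yX;
  [apply: hX | apply: hY; rewrite inE]; rewrite // yX.
Qed.

(** * From [XY]-graphs to split graphs and back *)

Definition complete_Y B : sgraph T :=
  sgraph_of (fun x y => adj (xy_graph B) x y
                        || (x \notin xy_X B) && (y \notin xy_X B)).

Lemma adj_complete_Y B x y : adj (complete_Y B) x y =
  adj (xy_graph B) x y
  || [&& x != y, x \notin xy_X B & y \notin xy_X B].
Proof.
rewrite adj_sgraph_of (adj_sym _ y x) (andbC (y \notin _)) orbb.
by case: eqVneq => [->|//]; rewrite adj_irr.
Qed.

(** All edges added by [complete_Y] lie inside [Y], so completion loses nothing once [X] is
    known. *)
Lemma xy_adjE B x y : adj (xy_graph B) x y =
  adj (complete_Y B) x y && ((x \in xy_X B) != (y \in xy_X B)).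
Proof.
rewrite adj_complete_Y; case: (boolP (adj _ x y)) => [/xy_adj_cross -> //|_].
by case: (x \in _); case: (y \in _); rewrite ?andbF.
Qed.

Lemma cross_subproof G S :
  xygraph_axiom (sgraph_of (fun x y => adj G x y && ((x \in S) != (y \in S))), S).
Proof.
by apply/andP; split; apply/stableP=> x y /=; rewrite ?inE => xS yS;
  rewrite adj_sgraph_of ?(negbTE xS) ?(negbTE yS) ?xS ?yS /= !andbF.
Qed.

Definition cross G S : xygraph T := XYGraph (cross_subproof G S).

Lemma adj_cross G S x y :
  adj (xy_graph (cross G S)) x y = adj G x y && ((x \in S) != (y \in S)).
Proof.
rewrite adj_sgraph_of (adj_sym _ y x) (eq_sym (y \in S)) orbb.
by case: eqVneq => [->|//]; rewrite adj_irr.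
Qed.

Lemma complete_Y_cross G S :
  stable G S -> clique G (~: S) -> complete_Y (cross G S) = G.
Proof.
move=> /stableP hS /cliqueP hK; apply: sgraph_eq => x y.
rewrite adj_complete_Y adj_cross -[xy_X _]/S.
case: (boolP (x \in S)) => xS; case: (boolP (y \in S)) => yS;
  rewrite ?andbT ?andbF ?orbF //=.
  by rewrite (negbTE (hS _ _ xS yS)).
apply/idP/idP=> [|xy]; first by apply: hK; rewrite inE.
by apply: contraTneq xy => ->; rewrite adj_irr.
Qed.

(** * Split partitions with dominating stable part *)

(** Here [S] is a maximal stable set with clique complement; the last clause says that [cross G S]
    has no isolates in [Y]. *)
Definition dominating_split G S :=
  [/\ stable G S, clique G (~: S) &
      forall v, v \notin S -> exists2 u, u \in S & adj G u v].

Lemma dominating_split_iso G H (s : {perm T}) S : is_iso G H s ->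
  dominating_split G S -> dominating_split H (s @: S).
Proof.
move=> /is_isoP hs [/stableP hS /cliqueP hK hD].
have sE := imset_permP s S _ (eqxx _).
split.
- by apply/stableP=> _ _ /imsetP[x xS ->] /imsetP[y yS ->]; rewrite hs hS.
- apply/cliqueP=> x y; rewrite -(permKV s x) -(permKV s y) !inE !sE hs.
  by move=> xS yS; rewrite (inj_eq perm_inj); apply: hK; rewrite inE.
move=> v; rewrite -(permKV s v) sE => /hD[u uS uv].
by exists (s u); rewrite ?sE ?hs.
Qed.

(** A vertex of [S'] outside [S] would have a neighbor in [S], hence in [S'], which is stable. *)
Lemma dominating_split_subset G S S' :
  dominating_split G S -> dominating_split G S' -> S \subset S' -> S = S'.
Proof.
move=> [_ _ hD] [/stableP hS' _ _] sub; apply/eqP; rewrite eqEsubset sub /=.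
apply/subsetP=> v vS'; apply: contraT => /hD[u uS uv].
by rewrite (negbTE (hS' _ _ _ vS')) ?(subsetP sub) in uv.
Qed.

(** Applied to one stable part and the complement of another, this leaves at most one vertex in
    their difference. *)
Lemma stable_clique_inj G S K x y : stable G S -> clique G K ->
  x \in S -> y \in S -> x \in K -> y \in K -> x = y.
Proof.
move=> /stableP hS /cliqueP hK xS yS xK yK; apply: contraTeq isT => xy.
by have := hS x y xS yS; rewrite hK.
Qed.

Lemma twins_tperm_iso G a b :
    (forall v, v != a -> v != b -> adj G a v = adj G b v) ->
  is_iso G G (tperm a b).
Proof.
move=> tw; apply/is_isoP=> x y.
case: tpermP => [->|->|/eqP xa /eqP xb]; case: tpermP => [->|->|/eqP ya /eqP yb];
  rewrite ?adj_irr //; try exact: adj_sym.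
- by rewrite tw.
- by rewrite tw.
- by rewrite !(adj_sym _ x) tw.
- by rewrite !(adj_sym _ x) tw.
Qed.

Lemma dominating_split_transitive G S S' :
    dominating_split G S -> dominating_split G S' ->
  exists2 t, is_iso G G t & t @: S = S'.
Proof.
move=> dS dS'; have [eqS|neqS] := eqVneq S S'.
  exists 1%g; first exact: is_iso1.
  by rewrite (eq_imset _ (@perm1 T)) imset_id.
(* Distinct dominating stable parts are incomparable, so each has a vertex outside the other. *)
have [a aS aS'] : exists2 a, a \in S & a \notin S'.
  apply/subsetPn; apply: contra neqS => sub.
  by rewrite (dominating_split_subset dS dS' sub).
have [b bS' bS] : exists2 b, b \in S' & b \notin S.
  apply/subsetPn; apply: contra neqS => sub.
  by rewrite (dominating_split_subset dS' dS sub).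
have [stS clS _] := dS; have [stS' clS' _] := dS'.
have agree v : v != a -> v != b -> (v \in S) = (v \in S').
  move=> va vb; apply/idP/idP=> vS; apply: contraT => vS'.
    by case/eqP: va; apply: stable_clique_inj stS clS' _ _ _ _; rewrite ?inE.
  by case/eqP: vb; apply: stable_clique_inj stS' clS _ _ _ _; rewrite ?inE.
exists (tperm a b).
  (* If [v] lies in both stable parts, it is adjacent to neither [a] nor [b]. If it lies in neither,
     it shares the clique [~: S'] with [a] and the clique [~: S] with [b], so it is adjacent to
     both. *)
  apply: twins_tperm_iso => v va vb; have := agree v va vb.
  case: (boolP (v \in S)) => vS /esym vS'.
    by rewrite (negbTE (stableP _ _ stS _ _ aS vS))
      (negbTE (stableP _ _ stS' _ _ bS' vS')).
  rewrite (cliqueP _ _ clS') ?inE ?vS' // 1?eq_sym //.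
  by rewrite (cliqueP _ _ clS) ?inE // eq_sym.
apply/eqP/imset_permP=> x; case: tpermP => [->|->|/eqP xa /eqP xb].
- by rewrite bS' aS.
- by rewrite (negbTE aS') (negbTE bS).
by rewrite agree.
Qed.

(** * The correspondence up to isomorphism *)

Lemma dominating_split_complete_Y B :
  no_isolates_in_Y B -> dominating_split (complete_Y B) (xy_X B).
Proof.
move=> /forall_inP noI; split.
- apply/stableP=> x y xX yX; rewrite adj_complete_Y xX andbF orbF.
  by apply/negP=> /xy_adj_cross; rewrite xX yX.
- by apply/cliqueP=> x y; rewrite !inE adj_complete_Y => -> -> ->; rewrite orbT.
move=> v vX; have : v \in xy_Y B by rewrite inE.
move/noI/forallPn=> [u /negPn uv]; exists u; last by rewrite adj_complete_Y uv.
by have := xy_adj_cross uv; rewrite (negbTE vX); case: (u \in _).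
Qed.

Lemma dominating_split_ex G : is_split G -> exists S, dominating_split G S.
Proof.
case/existsP=> K /existsP[S0 /and4P[/eqP KS dKS clK stS0]].
have KE : K = ~: S0.
  apply/setP=> x; have /setP/(_ x) := KS; rewrite !inE.
  case: (boolP (x \in K)) => [/(disjointFr dKS) -> //|_ /= ->//].
pose P S := stable G S && clique G (~: S).
have P0 : P S0 by rewrite /P stS0 -KE.
(* Take [S] of maximum size: a clique vertex without neighbor in [S] could be added to [S], leaving
   a smaller clique as complement. *)
have [S /andP[/stableP stS /cliqueP clS] Smax] :=
  @arg_maxnP _ S0 P (fun S => #|S|) P0.
exists S; split; [exact/stableP | exact/cliqueP | move=> v vS].
apply/exists_inP; apply: contraT => /exists_inPn nadj.
have /Smax : P (v |: S).
  apply/andP; split.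
    apply/stableP=> x y /setU1P[->|xS] /setU1P[->|yS].
    - by rewrite adj_irr.
    - by rewrite adj_sym nadj.
    - exact: nadj.
    - exact: stS.
  apply/cliqueP=> x y; rewrite !inE !negb_or => /andP[_ xS] /andP[_ yS].
  by apply: clS; rewrite inE.
by rewrite /= cardsU1 vS ltnn.
Qed.

Lemma complete_Y_split B : no_isolates_in_Y B -> is_split (complete_Y B).
Proof.
case/dominating_split_complete_Y=> st cl _.
apply/existsP; exists (~: xy_X B); apply/existsP; exists (xy_X B).
by rewrite setUC setUCr eqxx cl st -setI_eq0 setIC setICr eqxx.
Qed.

Lemma complete_Y_surj G : is_split G ->
  exists2 B, no_isolates_in_Y B & complete_Y B = G.
Proof.
case/dominating_split_ex=> S [st cl dom].
exists (cross G S); last exact: complete_Y_cross.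
apply/forall_inP=> v; rewrite inE -[xy_X _]/S => vS.
have [u uS uv] := dom v vS; apply/forallPn; exists u.
by rewrite negbK adj_cross uv uS (negbTE vS).
Qed.

Lemma complete_Y_iso B C : no_isolates_in_Y B -> no_isolates_in_Y C ->
  sg_iso (complete_Y B) (complete_Y C) = xy_iso B C.
Proof.
move=> noB noC; apply/existsP/xy_isoP=> -[s hs]; last first.
  move: hs => /is_isoP hs hX; exists s; apply/is_isoP=> x y.
  by rewrite !adj_complete_Y hs !hX (inj_eq perm_inj).
(* The isomorphism [s] may send [xy_X B] to a dominating stable part other than [xy_X C]; an
   automorphism [t] of [complete_Y C] corrects this. *)
have dB := dominating_split_iso hs (dominating_split_complete_Y noB).
have [t ht tX] :=
  dominating_split_transitive dB (dominating_split_complete_Y noC).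
have /imset_permP stX : (s * t)%g @: xy_X B == xy_X C by rewrite imset_permM tX.
exists (s * t)%g => //; apply/is_isoP=> x y.
by rewrite !xy_adjE !stX (is_isoP _ _ _ (is_isoM hs ht)).
Qed.

End SplitXY.

Theorem theorem3p3 (n : nat) :
  exists f : {C : {set sgraph 'I_n} | C \in split_classes n} ->
             {D : {set xygraph 'I_n} | D \in xy_classes n},
    bijective f.
Proof.
(* A class of split graphs is sent to the set of [XY]-graphs without isolates in [Y] whose
   completion lies in it. *)
apply: (@equivalence_partition_bij _ _ _ _ _ _ (@complete_Y 'I_n)).
- exact: sg_iso_sym.
- exact: sg_iso_trans.
- exact: xy_iso_refl.
- by move=> B; rewrite !inE; apply: complete_Y_split.
- by move=> B C; rewrite !inE; apply: complete_Y_iso.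
move=> G; rewrite inE => /complete_Y_surj[B noB <-].
by exists B; rewrite ?inE ?sg_iso_refl.
Qed.
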